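(* $$16\log 2=\sum_{j=0}^{\infty}\left(-\frac14\right)^{j}\frac{\left(\frac34\right)_j(1)_j\left(\frac54\right)_j}{\left(\frac32\right)_j\left(\frac32\right)_j\left(\frac32\right)_j}\,(20j+13).$$
   Context: $(x)_0=1$ and $(x)_j=x(x+1)\cdots(x+j-1)$ for positive integers $j$ (rising factorial); $\log$ is the natural logarithm. *)

(* Defs.v *)
From Stdlib Require Import Reals.
From Coquelicot Require Import Coquelicot.

Open Scope R_scope.

(* The Pochhammer symbol (x)_j, in the rising convention. *)
Fixpoint rising (x : R) (j : nat) : R :=
  match j with
  | O => 1
  | S k => rising x k * (x + INR k)
  end.

(* Main.v *)
Require Import Defs.
From Stdlib Require Import Reals Lra Lia.
From Coquelicot Require Import Coquelicot.

Open Scope R_scope.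

(** The series is the edge k = 0 of a Wilf-Zeilberger pair. There are a
    hypergeometric kernel c(n, k), a linear factor and a rational certificate
    such that T(n, k) = (20 n + 22 k + 13) c(n, k) and the mate
      H(n, k) = (16 n^2 + (36 + 56 k) n + (3/2) (2 k + 1) (14 k + 11))
                / (n + 2 k + 3/2) * c(n, k)
    satisfy T(n, k+1) - T(n, k) = H(n+1, k) - H(n, k) ([wz_identity]), and
    T(n, 0) is the given summand ([wz_term_0_r]). Summing over a square
    ([wz_rectangle]) equates the partial sum along the edge k = 0 with the
    partial sum of H(0, k) along the edge n = 0, up to the sums over the two
    far edges. Since |c(n, k)| <= 4^(-n) 16^(-k) ([kernel_bound]), those far
    edges vanish in the limit.

    The edge n = 0 is a series that a Beta integral sums: H(0, k) equals
    (14 k + 11) 64^(-k) (1)_(2k) / (5/2)_(2k), and (1)_m / (5/2)_m is the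
    integral of 3 t^2 (1 - t^2)^m over [0, 1]. With z = ((1 - t^2) / 8)^2 the
    sum over k becomes the integral over [0, 1] of
      3 t^2 (11 / (1 - z) + 14 z / (1 - z)^2),
    where 1 - z = (7 + t^2) (9 - t^2) / 64. The factor 7 + t^2 could
    contribute an arctangent, but its contributions cancel, and the integrand
    is the derivative of
      16 ln ((3 + t) / (3 - t)) - 672 t (1 - t^2) / ((7 + t^2) (9 - t^2)),
    which gives 16 ln 2 ([is_RInt_tail_integrand_0]). *)

(** * Rising factorials and finite sums *)

Lemma rising_pos (x : R) (j : nat) : 0 < x -> 0 < rising x j.
Proof.
  intros Hx; induction j as [|j IH]; cbn [rising]; [lra|].
  pose proof (pos_INR j). apply Rmult_lt_0_compat; lra.
Qed.

Lemma rising_double (x : R) (j : nat) :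
  rising x (2 * j) = 4 ^ j * rising (x / 2) j * rising ((x + 1) / 2) j.
Proof.
  induction j as [|j IH]; [cbn; ring|].
  replace (2 * S j)%nat with (S (S (2 * j))) by lia.
  cbn [rising pow]. rewrite IH, S_INR, mult_INR. cbn [INR]. field.
Qed.

Lemma sum_n_S (f : nat -> R) (N : nat) : sum_n f (S N) = sum_n f N + f (S N).
Proof. exact (sum_Sn f N). Qed.

Lemma sum_n_Rabs_le (f : nat -> R) (N : nat) (B : R) :
  (forall n, (n <= N)%nat -> Rabs (f n) <= B) ->
  Rabs (sum_n f N) <= (INR N + 1) * B.
Proof.
  induction N as [|N IH]; intros H.
  - rewrite sum_O. pose proof (H 0%nat (le_n _)). cbn [INR]. lra.
  - rewrite sum_n_S, S_INR.
    pose proof (H (S N) (le_n _)).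
    pose proof (IH (fun n Hn => H n (le_S _ _ Hn))).
    pose proof (Rabs_triang (sum_n f N) (f (S N))). lra.
Qed.

(** * The Wilf-Zeilberger pair *)

(** The summand without its linear factor, deformed by an integer k. In Gamma
    functions it is, up to a constant, (-1/16)^n (1/16)^k times
    Gamma(n+k+1) Gamma(2n+k+3/2) Gamma(k+1/2)^2
    / (Gamma(n+k+3/2)^2 Gamma(n+2k+3/2)). Moving along k raises n and a
    denominator parameter together; this is what makes both edges of the
    quadrant decay geometrically. *)
Definition kernel (n k : nat) : R :=
  (- (1 / 16)) ^ n * (1 / 16) ^ k
  * (rising 1 (n + k) * rising (3 / 2) (2 * n + k) * rising (1 / 2) k ^ 2)
  / (rising (3 / 2) (n + k) ^ 2 * rising (3 / 2) (n + 2 * k)).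

Definition wz_term (n k : nat) : R := (20 * INR n + 22 * INR k + 13) * kernel n k.

(** The certificate H/c comes from Gosper summation of T(n, k+1) - T(n, k)
    in n, with k as a parameter. *)
Definition wz_mate (n k : nat) : R :=
  (16 * INR n ^ 2 + (36 + 56 * INR k) * INR n
   + 3 / 2 * (2 * INR k + 1) * (14 * INR k + 11))
  / (INR n + 2 * INR k + 3 / 2) * kernel n k.

Lemma kernel_S_l (n k : nat) :
  kernel (S n) k = kernel n k *
    (- ((INR n + INR k + 1) * (2 * INR n + INR k + 3 / 2) * (2 * INR n + INR k + 5 / 2))
     / (16 * (INR n + INR k + 3 / 2) ^ 2 * (INR n + 2 * INR k + 3 / 2))).
Proof.
  unfold kernel.
  replace (2 * S n + k)%nat with (S (S (2 * n + k))) by lia.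
  replace (S n + k)%nat with (S (n + k)) by lia.
  replace (S n + 2 * k)%nat with (S (n + 2 * k)) by lia.
  cbn [rising]. rewrite <- tech_pow_Rmult, !S_INR, !plus_INR, !mult_INR. cbn [INR].
  pose proof (pos_INR n); pose proof (pos_INR k).
  pose proof (rising_pos (3 / 2) (n + k) ltac:(lra)).
  pose proof (rising_pos (3 / 2) (n + 2 * k) ltac:(lra)).
  field. repeat split; lra.
Qed.

Lemma kernel_S_r (n k : nat) :
  kernel n (S k) = kernel n k *
    (((INR n + INR k + 1) * (2 * INR n + INR k + 3 / 2) * (INR k + 1 / 2) ^ 2)
     / (16 * (INR n + INR k + 3 / 2) ^ 2
        * (INR n + 2 * INR k + 3 / 2) * (INR n + 2 * INR k + 5 / 2))).
Proof.
  unfold kernel.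
  replace (2 * n + S k)%nat with (S (2 * n + k)) by lia.
  replace (n + S k)%nat with (S (n + k)) by lia.
  replace (n + 2 * S k)%nat with (S (S (n + 2 * k))) by lia.
  cbn [rising]. rewrite <- (tech_pow_Rmult (1 / 16)), !S_INR, !plus_INR, !mult_INR. cbn [INR].
  pose proof (pos_INR n); pose proof (pos_INR k).
  pose proof (rising_pos (3 / 2) (n + k) ltac:(lra)).
  pose proof (rising_pos (3 / 2) (n + 2 * k) ltac:(lra)).
  field. repeat split; lra.
Qed.

(** The numerator (3/2)_(2j) of the kernel is 4^j (3/4)_j (5/4)_j, which turns
    the base -1/16 into -1/4. *)
Lemma wz_term_0_r (j : nat) :
  (- (1 / 4)) ^ j
  * ((rising (3 / 4) j * rising 1 j * rising (5 / 4) j)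
     / (rising (3 / 2) j * rising (3 / 2) j * rising (3 / 2) j))
  * (20 * INR j + 13) = wz_term j 0.
Proof.
  unfold wz_term, kernel.
  rewrite !Nat.add_0_r, rising_double.
  replace (3 / 2 / 2) with (3 / 4) by field.
  replace ((3 / 2 + 1) / 2) with (5 / 4) by field.
  replace (- (1 / 4)) with (- (1 / 16) * 4) by field.
  rewrite Rpow_mult_distr. cbn [rising pow INR].
  pose proof (rising_pos (3 / 2) j ltac:(lra)).
  field. lra.
Qed.

(** After division by c(n, k) both sides are rational functions of n and k,
    by the two ratio lemmas. *)
Lemma wz_identity (n k : nat) :
  wz_term n (S k) - wz_term n k = wz_mate (S n) k - wz_mate n k.
Proof.
  unfold wz_term, wz_mate. rewrite kernel_S_l, kernel_S_r, !S_INR.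
  pose proof (pos_INR n); pose proof (pos_INR k).
  field. repeat split; lra.
Qed.

Lemma wz_row_difference (N k : nat) :
  sum_n (fun n => wz_term n (S k)) N - sum_n (fun n => wz_term n k) N
  = wz_mate (S N) k - wz_mate 0 k.
Proof.
  induction N as [|N IH].
  - rewrite !sum_O. apply wz_identity.
  - rewrite !sum_n_S. pose proof (wz_identity (S N) k). lra.
Qed.

(** The discrete Green formula for the pair on a rectangle: the double sum of
    the identity telescopes in both directions. *)
Lemma wz_rectangle (N K : nat) :
  sum_n (fun n => wz_term n 0) N
  = sum_n (fun n => wz_term n (S K)) N
    - sum_n (wz_mate (S N)) K + sum_n (wz_mate 0) K.
Proof.
  induction K as [|K IH].
  - rewrite !(sum_O (wz_mate _)). pose proof (wz_row_difference N 0). lra.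
  - rewrite !(sum_n_S (wz_mate _)).
    pose proof (wz_row_difference N (S K)). lra.
Qed.

(** * Decay on the far edges *)

(** The ratio in k at n = 0 is at most 1/16 and the ratio in n is at most 1/4
    in absolute value. *)
Lemma kernel_bound (n k : nat) : Rabs (kernel n k) <= (1 / 4) ^ n * (1 / 16) ^ k.
Proof.
  induction n as [|n IHn].
  - induction k as [|k IHk].
    + unfold kernel; cbn. rewrite Rabs_right; lra.
    + rewrite kernel_S_r, Rabs_mult. cbn [INR pow].
      pose proof (pos_INR k).
      replace (1 * (1 / 16 * (1 / 16) ^ k)) with (1 * (1 / 16) ^ k * (1 / 16)) by ring.
      apply Rmult_le_compat; try apply Rabs_pos; [exact IHk|].
      rewrite Rabs_right.
      * apply Rle_div_l; [apply Rmult_lt_0_compat|]; nra.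
      * apply Rle_ge, Rdiv_le_0_compat; [|apply Rmult_lt_0_compat]; nra.
  - rewrite kernel_S_l, Rabs_mult, <- (tech_pow_Rmult (1 / 4)).
    pose proof (pos_INR k); pose proof (pos_INR n).
    set (a := INR n) in *; set (b := INR k) in *.
    replace (1 / 4 * (1 / 4) ^ n * (1 / 16) ^ k)
      with ((1 / 4) ^ n * (1 / 16) ^ k * (1 / 4)) by ring.
    apply Rmult_le_compat; try apply Rabs_pos; [exact IHn|].
    assert (Hd : 0 < 16 * (a + b + 3 / 2) ^ 2 * (a + 2 * b + 3 / 2))
      by (repeat apply Rmult_lt_0_compat; lra).
    rewrite Rdiv_opp_l, Rabs_Ropp, Rabs_right.
    + apply Rle_div_l; [exact Hd|].
      (* The three numerator factors are dominated one by one. *)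
      replace (1 / 4 * (16 * (a + b + 3 / 2) ^ 2 * (a + 2 * b + 3 / 2)))
        with ((a + b + 3 / 2) * (2 * (a + b + 3 / 2)) * (2 * (a + 2 * b + 3 / 2))) by field.
      apply Rmult_le_compat; [apply Rmult_le_pos| |apply Rmult_le_compat|]; lra.
    + apply Rle_ge, Rdiv_le_0_compat; [|exact Hd].
      apply Rmult_le_pos; [apply Rmult_le_pos|]; lra.
Qed.

Lemma quarter_pow_antitone (m n : nat) : (m <= n)%nat -> (1 / 4) ^ n <= (1 / 4) ^ m.
Proof.
  induction 1 as [|n _ IH]; [lra|]. cbn [pow].
  pose proof (pow_lt (1 / 4) n ltac:(lra)). lra.
Qed.

Lemma kernel_bound_far (N n k : nat) :
  (N <= n + k)%nat -> Rabs (kernel n k) <= (1 / 4) ^ N.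
Proof.
  intros H. eapply Rle_trans; [apply kernel_bound|].
  eapply Rle_trans; [|apply (quarter_pow_antitone _ _ H)].
  rewrite pow_add. apply Rmult_le_compat_l; [apply pow_le; lra|].
  apply pow_incr; lra.
Qed.

Lemma wz_term_bound (N n : nat) :
  (n <= N)%nat -> Rabs (wz_term n (S N)) <= (42 * INR N + 35) * (1 / 4) ^ N.
Proof.
  intros H. pose proof (pos_INR n). pose proof (le_INR _ _ H).
  unfold wz_term. rewrite Rabs_mult, S_INR.
  apply Rmult_le_compat; try apply Rabs_pos.
  - rewrite Rabs_right; lra.
  - apply kernel_bound_far; lia.
Qed.

Lemma wz_mate_bound (N k : nat) :
  (k <= N)%nat -> Rabs (wz_mate (S N) k) <= (42 * INR N + 35) * (1 / 4) ^ N.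
Proof.
  intros H. pose proof (pos_INR k). pose proof (le_INR _ _ H).
  unfold wz_mate. rewrite Rabs_mult, S_INR.
  apply Rmult_le_compat; try apply Rabs_pos.
  - set (a := INR N) in *; set (b := INR k) in *.
    rewrite Rabs_right.
    + apply Rle_div_l; [lra|].
      (* The quotient of the certificate grows linearly: this multiple of its
         denominator dominates its numerator coefficient by coefficient. *)
      apply Rle_trans with ((16 * (a + 1) + 24 * b + 12) * (a + 1 + 2 * b + 3 / 2)); nra.
    + apply Rle_ge, Rdiv_le_0_compat; nra.
  - apply kernel_bound_far; lia.
Qed.

(** * The edge n = 0 as an integral *)

(** Half of a Beta integral, by recursion on m: expanding
    t^4 = t^2 - t^2 (1 - t^2) in the derivative of t^3 (1 - t^2)^(m+1), which
    vanishes at both ends, relates consecutive integrals by the factor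
    (2 m + 2) / (2 m + 5). *)
Lemma is_RInt_beta (m : nat) :
  is_RInt (fun t => 3 * t ^ 2 * (1 - t ^ 2) ^ m) 0 1 (rising 1 m / rising (5 / 2) m).
Proof.
  induction m as [|m IH].
  - cbn [rising pow].
    replace (1 / 1) with (minus (1 ^ 3) (0 ^ 3)) by (unfold minus, plus, opp; cbn; field).
    apply (is_RInt_derive (fun t => t ^ 3)).
    + intros t _. auto_derive; [trivial|]. cbn. ring.
    + intros t _. apply (ex_derive_continuous (K := R_AbsRing) (V := R_NormedModule)).
      auto_derive; trivial.
  - pose proof (pos_INR m).
    set (F := fun t : R => t ^ 3 * (1 - t ^ 2) ^ S m).
    set (F' := fun t : R => 3 * t ^ 2 * (1 - t ^ 2) ^ S m
                            - 2 * (INR m + 1) * t ^ 4 * (1 - t ^ 2) ^ m).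
    assert (HF : is_RInt F' 0 1 (minus (F 1) (F 0))).
    { apply (is_RInt_derive F).
      - intros t _. unfold F, F'. auto_derive; [trivial|].
        change (match m with O => 1 | S _ => INR m + 1 end) with (INR (S m)).
        rewrite S_INR. unfold Rminus. cbn [pow]. ring.
      - intros t _. unfold F'.
        apply (ex_derive_continuous (K := R_AbsRing) (V := R_NormedModule)).
        auto_derive; trivial. }
    replace (minus (F 1) (F 0)) with 0 in HF
      by (unfold F, minus, plus, opp; cbn; ring).
    pose proof (is_RInt_scal _ _ _ (3 / (2 * INR m + 5)) _ HF) as H1.
    pose proof (is_RInt_scal _ _ _ ((2 * INR m + 2) / (2 * INR m + 5)) _ IH) as H2.
    pose proof (is_RInt_plus _ _ _ _ _ _ H1 H2) as H3.
    replace (rising 1 (S m) / rising (5 / 2) (S m))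
      with (plus (scal (3 / (2 * INR m + 5)) 0)
              (scal ((2 * INR m + 2) / (2 * INR m + 5)) (rising 1 m / rising (5 / 2) m))).
    + revert H3. apply is_RInt_ext. intros t _.
      unfold F', plus, scal; cbn. unfold mult; cbn. field. lra.
    + unfold plus, scal; cbn. unfold mult; cbn.
      pose proof (rising_pos (5 / 2) m ltac:(lra)). field. lra.
Qed.

(** At n = 0 the factors (1/2)_k / (3/2)_k = 1 / (2 k + 1) cancel the factor
    2 k + 1 of the certificate, and (1)_k (1/2)_k = 4^(-k) (1)_(2k). *)
Lemma wz_mate_0_l (k : nat) :
  wz_mate 0 k
  = (14 * INR k + 11) * (1 / 64) ^ k * (rising 1 (2 * k) / rising (5 / 2) (2 * k)).
Proof.
  assert (E : kernel 0 k * (3 * (2 * INR k + 1) / (4 * INR k + 3))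
              = (1 / 64) ^ k * (rising 1 (2 * k) / rising (5 / 2) (2 * k))).
  { induction k as [|k IH]; [unfold kernel; cbn; field|].
    pose proof (pos_INR k).
    pose proof (rising_pos (5 / 2) (2 * k) ltac:(lra)).
    replace (2 * S k)%nat with (S (S (2 * k))) by lia.
    cbn [rising pow]. rewrite kernel_S_r, !S_INR, mult_INR. cbn [INR].
    transitivity (kernel 0 k * (3 * (2 * INR k + 1) / (4 * INR k + 3))
       * (1 / 64 * ((2 * INR k + 1) * (2 * INR k + 2)
           / ((2 * INR k + 5 / 2) * (2 * INR k + 7 / 2))))).
    - field. repeat split; lra.
    - rewrite IH. field. repeat split; lra. }
  unfold wz_mate. rewrite (Rmult_assoc (14 * INR k + 11)), <- E. cbn [INR].
  pose proof (pos_INR k). field. lra.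
Qed.

(** The sum over k >= K of the integrands 3 t^2 (14 k + 11) z^k of H(0, k), in
    closed form. Having the tail explicitly replaces any exchange of a series
    with an integral. *)
Definition tail_integrand (K : nat) (t : R) : R :=
  let z := ((1 - t ^ 2) / 8) ^ 2 in
  3 * t ^ 2 * z ^ K * ((14 * INR K + 11) / (1 - z) + 14 * z / (1 - z) ^ 2).

Lemma is_RInt_wz_mate_0_l (k : nat) :
  is_RInt (fun t => (14 * INR k + 11) * (3 * t ^ 2 * (((1 - t ^ 2) / 8) ^ 2) ^ k))
    0 1 (wz_mate 0 k).
Proof.
  rewrite wz_mate_0_l.
  generalize (is_RInt_scal _ _ _ ((14 * INR k + 11) * (1 / 64) ^ k) _
                (is_RInt_beta (2 * k))).
  apply is_RInt_ext. intros t _. unfold scal; cbn -[pow INR Nat.mul]. unfold mult; cbn -[pow INR Nat.mul].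
  rewrite pow_mult.
  replace (((1 - t ^ 2) / 8) ^ 2) with (1 / 64 * (1 - t ^ 2) ^ 2) by field.
  rewrite Rpow_mult_distr. ring.
Qed.

Lemma square_bounds (t : R) : 0 <= t <= 1 -> 0 <= ((1 - t ^ 2) / 8) ^ 2 <= 1 / 64.
Proof.
  intros H. split; [apply pow2_ge_0|].
  assert (0 <= 1 - t ^ 2 <= 1) by nra.
  replace (1 / 64) with ((1 / 8) ^ 2) by field. apply pow_incr. lra.
Qed.

(** The antiderivative comes from partial fractions of the integrand, whose
    denominator is (7 + t^2)^2 (9 - t^2)^2; the rational part vanishes at
    both endpoints. *)
Lemma is_RInt_tail_integrand_0 : is_RInt (tail_integrand 0) 0 1 (16 * ln 2).
Proof.
  set (G := fun t : R => - 672 * (t * (1 - t ^ 2)) / ((7 + t ^ 2) * (9 - t ^ 2))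
                         + 16 * (ln (3 + t) - ln (3 - t))).
  replace (16 * ln 2) with (minus (G 1) (G 0)).
  2:{ unfold G, minus, plus, opp; cbn -[pow].
      replace (3 + 1) with (2 * 2) by ring. replace (3 - 1) with 2 by ring.
      rewrite ln_mult by lra. replace (3 - 0) with (3 + 0) by ring. field. }
  apply (is_RInt_derive G); rewrite Rmin_left, Rmax_right by lra; intros t Ht.
  - assert (D1 : 7 + t ^ 2 <> 0) by nra. assert (D2 : 9 - t ^ 2 <> 0) by nra.
    unfold G, tail_integrand. cbv zeta.
    replace (1 - ((1 - t ^ 2) / 8) ^ 2) with ((7 + t ^ 2) * (9 - t ^ 2) / 64) by field.
    auto_derive.
    + split; [exact (Rmult_integral_contrapositive_currified _ _ D1 D2) | lra].
    + cbn [INR pow] in *. field. repeat split; first [assumption | lra].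
  - unfold tail_integrand. pose proof (square_bounds t Ht).
    apply (ex_derive_continuous (K := R_AbsRing) (V := R_NormedModule)).
    auto_derive. cbn [pow] in *. repeat split; nra.
Qed.

(** Removing the first term of the tail at K gives the tail at K + 1. *)
Lemma is_RInt_tail_integrand (K : nat) :
  is_RInt (tail_integrand (S K)) 0 1 (16 * ln 2 - sum_n (wz_mate 0) K).
Proof.
  assert (step : forall k v, is_RInt (tail_integrand k) 0 1 v ->
            is_RInt (tail_integrand (S k)) 0 1 (v - wz_mate 0 k)).
  { intros k v Hv.
    generalize (is_RInt_minus _ _ _ _ _ _ Hv (is_RInt_wz_mate_0_l k)).
    apply is_RInt_ext. rewrite Rmin_left, Rmax_right by lra. intros t Ht.
    pose proof (square_bounds t ltac:(lra)) as Hz.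
    unfold minus, plus, opp, tail_integrand; cbn -[pow INR].
    revert Hz. generalize (((1 - t ^ 2) / 8) ^ 2). intros z Hz.
    rewrite S_INR. cbn [pow]. field. lra. }
  induction K as [|K IH].
  - rewrite sum_O. apply step, is_RInt_tail_integrand_0.
  - rewrite sum_n_S, Rminus_plus_distr.
    apply step, IH.
Qed.

Lemma tail_integrand_bound (K : nat) (t : R) :
  0 <= t <= 1 -> 0 <= tail_integrand K t <= (84 * INR K + 69) * (1 / 64) ^ K.
Proof.
  intros Ht. pose proof (square_bounds t Ht) as Hz. pose proof (pos_INR K).
  unfold tail_integrand. cbv zeta. revert Hz. generalize (((1 - t ^ 2) / 8) ^ 2). intros z Hz.
  assert (Hp : 0 <= z ^ K <= (1 / 64) ^ K)
    by (split; [apply pow_le; lra | apply pow_incr; lra]).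
  assert (Hu : 0 <= 3 * t ^ 2 * z ^ K <= 3 * (1 / 64) ^ K).
  { assert (0 <= t ^ 2 <= 1) by nra. split; [apply Rmult_le_pos; lra|].
    apply Rmult_le_compat; lra. }
  assert (H1 : 0 <= (14 * INR K + 11) / (1 - z) <= 28 * INR K + 22)
    by (split; [apply Rdiv_le_0_compat; lra | apply Rle_div_l; nra]).
  assert (H2 : 0 <= 14 * z / (1 - z) ^ 2 <= 1)
    by (split; [apply Rdiv_le_0_compat; nra | apply Rle_div_l; nra]).
  split; [apply Rmult_le_pos; lra|].
  replace ((84 * INR K + 69) * (1 / 64) ^ K)
    with (3 * (1 / 64) ^ K * (28 * INR K + 23)) by ring.
  apply Rmult_le_compat; lra.
Qed.

Lemma sum_wz_mate_0_l_error (N : nat) :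
  Rabs (sum_n (wz_mate 0) N - 16 * ln 2) <= (84 * INR N + 153) * (1 / 4) ^ N.
Proof.
  pose proof (is_RInt_tail_integrand N) as HI.
  assert (HC : forall v : R, is_RInt (fun _ => v) 0 1 ((1 - 0) * v))
    by (intros v; exact (is_RInt_const 0 1 v)).
  assert (HB : forall t, 0 < t < 1 -> 0 <= tail_integrand (S N) t
                <= (84 * INR (S N) + 69) * (1 / 64) ^ S N)
    by (intros t Ht; apply tail_integrand_bound; lra).
  pose proof (is_RInt_le _ _ _ _ _ _ Rle_0_1 (HC _) HI (fun t Ht => proj1 (HB t Ht))) as L.
  pose proof (is_RInt_le _ _ _ _ _ _ Rle_0_1 HI (HC _) (fun t Ht => proj2 (HB t Ht))) as U.
  rewrite S_INR in U. cbn [pow] in U.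
  pose proof (pos_INR N).
  assert (P : 0 <= (1 / 64) ^ N <= (1 / 4) ^ N)
    by (split; [apply pow_le; lra | apply pow_incr; lra]).
  rewrite <- Rabs_Ropp, Rabs_right by lra.
  nra.
Qed.

(** * Convergence of the partial sums *)

(** The quadratic on the left is chosen so that its double exceeds its value
    at N + 1, by N^2; a square such as (N + 1)^2 fails this at N = 1. *)
Lemma quadratic_le_pow2 (N : nat) : INR N ^ 2 + 2 * INR N + 3 <= 3 * 2 ^ N.
Proof.
  induction N as [|N IH]; [cbn; lra|].
  rewrite S_INR. cbn [pow] in *. pose proof (pos_INR N). nra.
Qed.

(** The far edges and the tail of the integral are each at most a quadratic in
    N times 4^(-N); the quadratic costs one factor 2^N. *)
Lemma partial_sum_error (N : nat) :
  Rabs (sum_n (fun n => wz_term n 0) N - 16 * ln 2) <= 360 * (1 / 2) ^ N.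
Proof.
  rewrite (wz_rectangle N N).
  pose proof (sum_n_Rabs_le _ _ _ (wz_term_bound N)) as B1.
  pose proof (sum_n_Rabs_le (wz_mate (S N)) _ _ (wz_mate_bound N)) as B2.
  pose proof (sum_wz_mate_0_l_error N) as B3.
  set (s1 := sum_n (fun n => wz_term n (S N)) N) in *.
  set (s2 := sum_n (wz_mate (S N)) N) in *.
  set (s3 := sum_n (wz_mate 0) N - 16 * ln 2) in *.
  replace (s1 - s2 + sum_n (wz_mate 0) N - 16 * ln 2) with (s1 + - s2 + s3)
    by (unfold s3; ring).
  pose proof (Rabs_triang (s1 + - s2) s3) as T1.
  pose proof (Rabs_triang s1 (- s2)) as T2. rewrite Rabs_Ropp in T2.
  pose proof (quadratic_le_pow2 N) as Q.
  assert (P : 0 < (1 / 4) ^ N) by (apply pow_lt; lra).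
  assert (E : 2 ^ N * (1 / 4) ^ N = (1 / 2) ^ N)
    by (rewrite <- Rpow_mult_distr; f_equal; field).
  pose proof (pos_INR N).
  apply Rle_trans with (120 * (3 * 2 ^ N) * (1 / 4) ^ N).
  - apply Rle_trans with (120 * (INR N ^ 2 + 2 * INR N + 3) * (1 / 4) ^ N); nra.
  - rewrite <- E. assert (0 < 2 ^ N) by (apply pow_lt; lra). nra.
Qed.

Theorem mainTheorem14 :
  is_series
    (fun j : nat =>
       (- (1 / 4)) ^ j
       * ((rising (3 / 4) j * rising 1 j * rising (5 / 4) j)
          / (rising (3 / 2) j * rising (3 / 2) j * rising (3 / 2) j))
       * (20 * INR j + 13))
    (16 * ln 2).
Proof.
  apply is_series_ext with (fun n => wz_term n 0).
  { intros j. symmetry. apply wz_term_0_r. }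
  change (is_lim_seq (sum_n (fun n => wz_term n 0)) (16 * ln 2)).
  assert (Z : is_lim_seq (fun N => 360 * (1 / 2) ^ N) 0).
  { replace (Finite 0) with (Rbar_mult 360 0) by (cbn; f_equal; ring).
    apply is_lim_seq_scal_l, is_lim_seq_geom. rewrite Rabs_right; lra. }
  apply is_lim_seq_le_le with
    (u := fun N => 16 * ln 2 - 360 * (1 / 2) ^ N)
    (w := fun N => 16 * ln 2 + 360 * (1 / 2) ^ N).
  - intros N. apply Rabs_le_between'. apply partial_sum_error.
  - replace (Finite (16 * ln 2)) with (Finite (16 * ln 2 - 0)) by (f_equal; ring).
    apply is_lim_seq_minus'; [apply is_lim_seq_const | exact Z].
  - replace (Finite (16 * ln 2)) with (Finite (16 * ln 2 + 0)) by (f_equal; ring).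
    apply is_lim_seq_plus'; [apply is_lim_seq_const | exact Z].
Qed.
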